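(* Let $G$ be any family of setoids over a setoid $B$, and let $F_\omega$ be the family of setoids over the setoid $A_\omega$ constructed from $(B,G)$ by iterating pullback formation along the construction stages $S$ (as defined in the context). Then the category $\mathcal C(A_\omega,F_\omega)$ has chosen pullbacks.
   Context: Setting: intensional Martin-Löf type theory with universe and W-types; logic is propositions-as-types ($\exists$ is $\Sigma$, etc.). $I(X,x,y)$ denotes the intensional identity type. Setoids. A setoid $A=(|A|,=_A)$ is a type with a (type-valued) equivalence relation; $\mathrm{Ext}(A,B)$ is the setoid of extensional (equality-respecting) functions with pointwise equality $=_{\rm ext}$. A (proof-irrelevant) family $F$ of setoids over a setoid $A$ is a setoid $F(x)$ for each $x\in A$ and $F(p)\in \mathrm{Ext}(F(x),F(y))$ for each $p:x=_Ay$, such that $F(\mathrm{ref}(x))=_{\rm ext}\mathrm{id}$, $F(p)=_{\rm ext}F(q)$ for all $p,q:x=_Ay$, and $F(q)\circ F(p)=_{\rm ext}F(q\circ p)$, where $q\circ p$ is the proof of transitivity. Category of a family. $\mathcal C=\mathcal C(A,F)$ has setoid of objects $\mathrm{Ob}(\mathcal C)=\mathcal C_0=A$; setoid of arrows $\mathrm{Arr}(\mathcal C)=\mathcal C_1=((\Sigma x,y:|A|)\mathrm{Ext}(F(x),F(y)),\sim)$ where $(x,y,f)\sim(u,v,g)$ iff there are $p:x=_Au$, $q:y=_Av$ with $F(q)\circ f=_{\rm ext}g\circ F(p)$; $\mathsf{dom}(x,y,f)=x$, $\mathsf{cod}(x,y,f)=y$, $\mathsf{id}(x)=(x,x,\mathrm{id}_{F(x)})$;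 and the composite of $(x,y,f)$ followed by $(u,v,g)$, given $p:y=_Au$, is $(x,v,g\circ F(p)\circ f)$. Construction. $S$ is the inductive type with constructors $\mathsf b:S$ and $\mathsf p(i,j,k):S$ for $i,j,k:S$. By recursion on $s:S$ define a setoid $A_s$ and a family $F_s$ of setoids over $A_s$: - $A_{\mathsf b}=B$, $F_{\mathsf b}=G$. - $A_{\mathsf p(i,j,k)}$ has as elements tuples $(a,b,c,d,q,f,g)$ with $a:A_i$, $b:A_j$, $c,d:A_k$, $q:c=_{A_k}d$, $f\in\mathrm{Ext}(F_i(a),F_k(c))$, $g\in\mathrm{Ext}(F_j(b),F_k(d))$; and $(a,b,c,d,q,f,g)\sim(a',b',c',d',q',f',g')$ iff there are $p_1:a=_{A_i}a'$, $p_2:b=_{A_j}b'$, $p_3:c=_{A_k}c'$, $p_4:d=_{A_k}d'$ with $F_k(p_3)\circ f=_{\rm ext}f'\circ F_i(p_1)$ and $F_k(p_4)\circ g=_{\rm ext}g'\circ F_j(p_2)$. - $F_{\mathsf p(i,j,k)}(a,b,c,d,q,f,g)$ is the setoid of triples $(x,y,r)$ with $x:F_i(a)$, $y:F_j(b)$, $r:F_k(q)(f(x))=_{F_k(d)}g(y)$, where $(x,y,r)\approx(x',y',r')$ iff $x=_{F_i(a)}x'$ and $y=_{F_j(b)}y'$. A proof $(p_1,p_2,p_3,p_4,\ldots)$ of $\sim$ acts by $(x,y,r)\mapsto(F_i(p_1)(x),F_j(p_2)(y),r')$ where $r'$ is the resulting proof of the required equation. Then $A_\omega=((\Sigma s:S)A_s,=_\omega)$,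 where $(s,a)=_\omega(s',a')$ iff there is $p:I(S,s,s')$ with $\mathrm{transport}_{\lambda s.A_s}(p)(a)=_{A_{s'}}a'$; here $\mathrm{transport}_{\lambda s.A_s}(p):A_s\to A_{s'}$ is the usual transport along $p$ (by $I$-elimination, identity on reflexivity). $F_\omega(s,a)=F_s(a)$, and for $(p,q):(s,a)=_\omega(s',a')$, $F_\omega(p,q)(x)=F_{s'}(q)(H_{s,s',p}(x))$, where $H_{s,s',p}:F_s(a)\to F_{s'}(\mathrm{transport}_{\lambda s.A_s}(p)(a))$ is defined by $I$-elimination, being the identity when $p$ is reflexivity. $F_\omega$ is a family of setoids over $A_\omega$. Chosen pullbacks. A category $\mathcal C$ has chosen pullbacks if there are two extensional functions $\mathrm p_1,\mathrm p_2:\mathrm M(\mathcal C)\to\mathrm{Arr}(\mathcal C)$ on the setoid $\mathrm M(\mathcal C)=\{(f,g)\in\mathrm{Arr}(\mathcal C)^2:\mathsf{cod}(f)=_{\mathrm{Ob}(\mathcal C)}\mathsf{cod}(g)\}$ such that for all $(f,g)\in\mathrm M(\mathcal C)$, the arrows $\mathrm p_1(f,g)$ (into $\mathsf{dom}(f)$) and $\mathrm p_2(f,g)$ (into $\mathsf{dom}(g)$) have the same domain and form, together with $f$ and $g$, a pullback square: $f\circ\mathrm p_1(f,g)=g\circ\mathrm p_2(f,g)$, with the usual universal property. *)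

(* Defs.v *)
From Stdlib Require Import CRelationClasses Eqdep_dec.

Set Implicit Arguments.
Unset Strict Implicit.

(* Logic is propositions-as-types throughout: relations are valued in [Type]
   and every existential statement below is a sigma type or a record in
   [Type], so the conclusions carry actual data. *)

Record Setoid := MkSetoid {
  car :> Type;
  seteq : crelation car;
  seteq_equiv : Equivalence seteq }.

Notation "x == y" := (seteq x y) (at level 70, no associativity).

Definition srefl (A : Setoid) (x : A) : x == x :=
  @Equivalence_Reflexive _ _ (seteq_equiv A) x.
Definition ssym (A : Setoid) (x y : A) (p : x == y) : y == x :=
  @Equivalence_Symmetric _ _ (seteq_equiv A) x y p.
Definition strans (A : Setoid) (x y z : A) (p : x == y) (q : y == z) : x == z :=
  @Equivalence_Transitive _ _ (seteq_equiv A) x y z p q.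

Record ExtMap (A B : Setoid) := MkExt {
  fn :> A -> B;
  fn_ext : forall x y : A, x == y -> fn x == fn y }.

Definition Ext (A B : Setoid) : Setoid.
Proof.
refine (@MkSetoid (ExtMap A B) (fun f g => forall x : A, f x == g x) _).
split.
- intros f x; apply srefl.
- intros f g h x; apply ssym, h.
- intros f g k h1 h2 x; exact (strans (h1 x) (h2 x)).
Defined.

Notation "f =ext g" := (@seteq (Ext _ _) f g) (at level 70, no associativity).

Definition idmap (A : Setoid) : ExtMap A A := @MkExt A A (fun x => x) (fun _ _ p => p).

Definition cmap (A B C : Setoid) (g : ExtMap B C) (f : ExtMap A B) : ExtMap A C :=
  @MkExt A C (fun x => g (f x)) (fun _ _ p => fn_ext g (fn_ext f p)).

Infix "\oe" := cmap (at level 40, left associativity).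

(* [act_irr] makes the family proof-irrelevant: the action does not depend on
   the chosen proof of equality. *)
Record Family (A : Setoid) := MkFamily {
  fam :> A -> Setoid;
  act : forall x y : A, x == y -> ExtMap (fam x) (fam y);
  act_refl : forall x, act (srefl x) =ext idmap (fam x);
  act_irr : forall x y (p q : x == y), act p =ext act q;
  act_trans : forall x y z (p : x == y) (q : y == z),
    act q \oe act p =ext act (strans p q) }.

Arguments act {A} f {x y} p.
Arguments act_refl {A} f x.
Arguments act_irr {A} f {x y} p q.
Arguments act_trans {A} f {x y z} p q.

Lemma act_id (A : Setoid) (F : Family A) (x : A) (p : x == x) (u : F x) :
  act F p u == u.
Proof. exact (strans (act_irr F p (srefl x) u) (act_refl F x u)). Qed.

Lemma act_comp (A : Setoid) (F : Family A) (x y z : A)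
  (p : x == y) (q : y == z) (r : x == z) (u : F x) :
  act F q (act F p u) == act F r u.
Proof. exact (strans (act_trans F p q u) (act_irr F _ r u)). Qed.

(* The setoid { (x, y) in A x B : f(x) =_C g(y) }; its equality ignores the
   proof component, so a map out of it cannot depend on that proof. *)
Record FibCar (A B C : Setoid) (f : ExtMap A C) (g : ExtMap B C) := MkFib {
  fib_fst : A;
  fib_snd : B;
  fib_eq : f fib_fst == g fib_snd }.
Arguments MkFib {A B C f g}.

Definition FibProd (A B C : Setoid) (f : ExtMap A C) (g : ExtMap B C) : Setoid.
Proof.
refine (@MkSetoid (FibCar f g)
  (fun u v => ((fib_fst u == fib_fst v) * (fib_snd u == fib_snd v))%type) _).
split.
- intros u; split; apply srefl.
- intros u v [h1 h2]; split; apply ssym; assumption.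
- intros u v w [h1 h2] [h3 h4]; split; eapply strans; eassumption.
Defined.

(* Composition is written in diagrammatic order: [comp] takes a pair (f, g)
   with cod f = dom g to "f followed by g". *)
Record Category := MkCategory {
  Ob : Setoid;
  Arr : Setoid;
  dom : ExtMap Arr Ob;
  cod : ExtMap Arr Ob;
  ident : ExtMap Ob Arr;
  comp : ExtMap (FibProd cod dom) Arr;
  dom_ident : forall x, dom (ident x) == x;
  cod_ident : forall x, cod (ident x) == x;
  dom_comp : forall f g (p : cod f == dom g), dom (comp (MkFib f g p)) == dom f;
  cod_comp : forall f g (p : cod f == dom g), cod (comp (MkFib f g p)) == cod g;
  comp_ident_l : forall f (p : cod (ident (dom f)) == dom f),
    comp (MkFib (ident (dom f)) f p) == f;
  comp_ident_r : forall f (p : cod f == dom (ident (cod f))),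
    comp (MkFib f (ident (cod f)) p) == f;
  comp_assoc : forall f g h (p : cod f == dom g) (q : cod g == dom h)
      (p' : cod (comp (MkFib f g p)) == dom h)
      (q' : cod f == dom (comp (MkFib g h q))),
    comp (MkFib (comp (MkFib f g p)) h p') ==
    comp (MkFib f (comp (MkFib g h q)) q') }.

Definition andthen (C : Category) (f g : Arr C) (p : cod C f == dom C g) : Arr C :=
  comp C (MkFib f g p).

(* f o h = g o k *)
Record CommSquare (C : Category) (f g h k : Arr C) : Type := {
  sq_left : cod C h == dom C f;
  sq_right : cod C k == dom C g;
  sq_dom : dom C h == dom C k;
  sq_comm : andthen sq_left == andthen sq_right }.

(* p1 o u = h and p2 o u = k *)
Record Mediates (C : Category) (p1 p2 h k u : Arr C) : Type := {
  med_left : cod C u == dom C p1;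
  med_right : cod C u == dom C p2;
  med_eq_left : andthen med_left == h;
  med_eq_right : andthen med_right == k }.

Record IsPullback (C : Category) (f g p1 p2 : Arr C) : Type := {
  pb_square : CommSquare f g p1 p2;
  pb_univ : forall h k : Arr C, CommSquare f g h k ->
    { u : Arr C &
      (Mediates p1 p2 h k u *
       (forall v : Arr C, Mediates p1 p2 h k v -> v == u))%type } }.

Definition Cospans (C : Category) : Setoid := FibProd (cod C) (cod C).

Definition HasChosenPullbacks (C : Category) : Type :=
  { p1 : ExtMap (Cospans C) (Arr C) &
  { p2 : ExtMap (Cospans C) (Arr C) &
    forall m : Cospans C, IsPullback (fib_fst m) (fib_snd m) (p1 m) (p2 m) } }.

Record FamArrow (A : Setoid) (F : Family A) := MkArrow {
  a_dom : A;
  a_cod : A;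
  a_map : ExtMap (F a_dom) (F a_cod) }.
Arguments MkArrow {A F}.

Definition arrow_eq (A : Setoid) (F : Family A) (f g : FamArrow F) : Type :=
  { p : a_dom f == a_dom g &
  { q : a_cod f == a_cod g &
    act F q \oe a_map f =ext a_map g \oe act F p } }.

Lemma arrow_eq_equiv (A : Setoid) (F : Family A) : Equivalence (@arrow_eq A F).
Proof.
split.
- intros f; exists (srefl _), (srefl _); intros x; cbn.
  eapply strans; [apply act_id|]; apply fn_ext, ssym, act_id.
- intros f g [p [q h]]; exists (ssym p), (ssym q); intros x; cbn.
  cbn in h.
  eapply strans; [|apply (act_id (F := F) (strans q (ssym q)))].
  eapply strans; [|apply (act_comp q (ssym q))].
  apply fn_ext, ssym; eapply strans; [apply h|].
  apply fn_ext; eapply strans; [apply act_comp|apply act_id].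
  Unshelve. exact (srefl _).
- intros f g k [p [q h]] [p' [q' h']].
  exists (strans p p'), (strans q q'); intros x; cbn in *.
  eapply strans; [apply ssym, (act_comp q q')|].
  eapply strans; [apply fn_ext, h|].
  eapply strans; [apply h'|].
  apply fn_ext, act_comp.
Defined.

Definition ArrSetoid (A : Setoid) (F : Family A) : Setoid :=
  MkSetoid (arrow_eq_equiv F).

Definition fam_dom (A : Setoid) (F : Family A) : ExtMap (ArrSetoid F) A :=
  @MkExt (ArrSetoid F) A (@a_dom A F) (fun _ _ e => projT1 e).

Definition fam_cod (A : Setoid) (F : Family A) : ExtMap (ArrSetoid F) A :=
  @MkExt (ArrSetoid F) A (@a_cod A F) (fun _ _ e => projT1 (projT2 e)).

Definition fam_ident (A : Setoid) (F : Family A) : ExtMap A (ArrSetoid F).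
Proof.
refine (@MkExt A (ArrSetoid F) (fun x => MkArrow x x (idmap (F x))) _).
intros x y p; exists p, p; intros u; apply srefl.
Defined.

Definition fam_comp (A : Setoid) (F : Family A) :
  ExtMap (FibProd (fam_cod F) (fam_dom F)) (ArrSetoid F).
Proof.
refine (@MkExt (FibProd (fam_cod F) (fam_dom F)) (ArrSetoid F)
  (fun w => MkArrow (a_dom (fib_fst w)) (a_cod (fib_snd w))
     (a_map (fib_snd w) \oe act F (fib_eq w) \oe a_map (fib_fst w))) _).
intros [f g e] [f' g' e'] [[p [q h]] [p' [q' h']]]; cbn in *.
exists p, q'; intros x; cbn.
eapply strans; [apply h'|]; apply fn_ext.
eapply strans; [apply (act_comp e p' (strans e p'))|].
eapply strans; [|apply fn_ext, h].
apply ssym, act_comp.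
Defined.

Definition CatOfFamily (A : Setoid) (F : Family A) : Category.
Proof.
refine (@MkCategory A (ArrSetoid F) (fam_dom F) (fam_cod F) (fam_ident F)
  (fam_comp F) _ _ _ _ _ _ _).
- intros x; apply srefl.
- intros x; apply srefl.
- intros f g p; apply srefl.
- intros f g p; apply srefl.
- intros f p; exists (srefl _), (srefl _); intros x; cbn.
  eapply strans; [apply act_id|]; apply fn_ext, act_irr.
- intros f p; exists (srefl _), (srefl _); intros x; cbn.
  eapply strans; [apply act_id|]; eapply strans; [apply act_id|].
  apply fn_ext, ssym, act_id.
- intros f g h p q p' q'; exists (srefl _), (srefl _); intros x; cbn in *.
  eapply strans; [apply act_id|].
  apply fn_ext; eapply strans; [apply act_irr|].
  apply fn_ext, fn_ext; eapply strans; [apply act_irr|].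
  apply fn_ext, fn_ext, ssym, act_id.
Defined.

Section PullbackStep.
Context (A1 A2 A3 : Setoid) (F1 : Family A1) (F2 : Family A2) (F3 : Family A3).

Record PbIdx := MkPbIdx {
  ix_a : A1;
  ix_b : A2;
  ix_c : A3;
  ix_d : A3;
  ix_q : ix_c == ix_d;
  ix_f : ExtMap (F1 ix_a) (F3 ix_c);
  ix_g : ExtMap (F2 ix_b) (F3 ix_d) }.

Record PbIdxEq (t t' : PbIdx) : Type := MkPbIdxEq {
  e_a : ix_a t == ix_a t';
  e_b : ix_b t == ix_b t';
  e_c : ix_c t == ix_c t';
  e_d : ix_d t == ix_d t';
  e_f : act F3 e_c \oe ix_f t =ext ix_f t' \oe act F1 e_a;
  e_g : act F3 e_d \oe ix_g t =ext ix_g t' \oe act F2 e_b }.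

Lemma PbIdxEq_equiv : Equivalence PbIdxEq.
Proof.
split.
- intros t; exists (srefl _) (srefl _) (srefl _) (srefl _); intros x; cbn;
  (eapply strans; [apply act_id|]; apply fn_ext, ssym, act_id).
- intros t t' [p1 p2 p3 p4 hf hg].
  exists (ssym p1) (ssym p2) (ssym p3) (ssym p4); intros x; cbn in *.
  + eapply strans; [|apply (act_id (F := F3) (strans p3 (ssym p3)))].
    eapply strans; [|apply (act_comp p3 (ssym p3))].
    apply fn_ext, ssym; eapply strans; [apply hf|].
    apply fn_ext; eapply strans; [apply act_comp|apply act_id].
    Unshelve. exact (srefl _).
  + eapply strans; [|apply (act_id (F := F3) (strans p4 (ssym p4)))].
    eapply strans; [|apply (act_comp p4 (ssym p4))].
    apply fn_ext, ssym; eapply strans; [apply hg|].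
    apply fn_ext; eapply strans; [apply act_comp|apply act_id].
    Unshelve. exact (srefl _).
- intros t t' t'' [p1 p2 p3 p4 hf hg] [p1' p2' p3' p4' hf' hg'].
  exists (strans p1 p1') (strans p2 p2') (strans p3 p3') (strans p4 p4');
    intros x; cbn in *.
  + eapply strans; [apply ssym, (act_comp p3 p3')|].
    eapply strans; [apply fn_ext, hf|].
    eapply strans; [apply hf'|]; apply fn_ext, act_comp.
  + eapply strans; [apply ssym, (act_comp p4 p4')|].
    eapply strans; [apply fn_ext, hg|].
    eapply strans; [apply hg'|]; apply fn_ext, act_comp.
Defined.

Definition PbSetoid : Setoid := MkSetoid PbIdxEq_equiv.

Record PbElt (t : PbIdx) := MkPbElt {
  el_x : F1 (ix_a t);
  el_y : F2 (ix_b t);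
  el_r : act F3 (ix_q t) (ix_f t el_x) == ix_g t el_y }.

Definition PbFiber (t : PbIdx) : Setoid.
Proof.
refine (@MkSetoid (PbElt t)
  (fun u v => ((el_x u == el_x v) * (el_y u == el_y v))%type) _).
split.
- intros u; split; apply srefl.
- intros u v [h1 h2]; split; apply ssym; assumption.
- intros u v w [h1 h2] [h3 h4]; split; eapply strans; eassumption.
Defined.

Lemma pb_act_eq (t t' : PbIdx) (e : PbIdxEq t t') (u : PbElt t) :
  act F3 (ix_q t') (ix_f t' (act F1 (e_a e) (el_x u))) ==
  ix_g t' (act F2 (e_b e) (el_y u)).
Proof.
destruct e as [p1 p2 p3 p4 hf hg]; destruct u as [x y r]; cbn in *.
eapply strans; [apply fn_ext, ssym, hf|].
eapply strans; [|apply hg].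
eapply strans; [|apply fn_ext, r].
eapply strans; [apply (act_comp p3 (ix_q t') (strans p3 (ix_q t')))|].
apply ssym, act_comp.
Defined.

Definition pb_act (t t' : PbIdx) (e : PbIdxEq t t') :
  ExtMap (PbFiber t) (PbFiber t').
Proof.
refine (@MkExt (PbFiber t) (PbFiber t') (fun u => MkPbElt (pb_act_eq e u)) _).
intros u v [h1 h2]; split; cbn; apply fn_ext; assumption.
Defined.

Definition PbFamily : Family PbSetoid.
Proof.
refine (@MkFamily PbSetoid PbFiber pb_act _ _ _).
- intros t u; split; cbn; apply act_id.
- intros t t' p q u; split; cbn; apply act_irr.
- intros t t' t'' p q u; split; cbn; apply act_comp.
Defined.

End PullbackStep.

Inductive Stage : Set :=
| st_b : Stage
| st_p : Stage -> Stage -> Stage -> Stage.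

Fixpoint stage_family (B : Setoid) (G : Family B) (s : Stage) :
    { A : Setoid & Family A } :=
  match s with
  | st_b => existT _ B G
  | st_p i j k =>
      existT _
        (PbSetoid (projT2 (stage_family G i)) (projT2 (stage_family G j))
           (projT2 (stage_family G k)))
        (PbFamily (projT2 (stage_family G i)) (projT2 (stage_family G j))
           (projT2 (stage_family G k)))
  end.

Section Omega.
Context (B : Setoid) (G : Family B).

Definition A_ (s : Stage) : Setoid := projT1 (stage_family G s).
Definition F_ (s : Stage) : Family (A_ s) := projT2 (stage_family G s).

(* The identity type I(S, s, s') is Leibniz equality [s = s']. *)
Definition transport (s s' : Stage) (p : s = s') (a : A_ s) : A_ s' :=
  eq_rect s (fun s => car (A_ s)) a s' p.

Definition H_ (s s' : Stage) (p : s = s') (a : A_ s) :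
    F_ s a -> F_ s' (transport p a) :=
  match p as p0 in _ = s0 return F_ s a -> F_ s0 (transport p0 a) with
  | eq_refl => fun x => x
  end.

Definition omega_eq (u v : { s : Stage & A_ s }) : Type :=
  { p : projT1 u = projT1 v & transport p (projT2 u) == projT2 v }.

Lemma omega_equiv : Equivalence omega_eq.
Proof.
split.
- intros [s a]; exists eq_refl; apply srefl.
- intros [s a] [s' a'] [p q]; cbn in *; destruct p.
  exists eq_refl; exact (ssym q).
- intros [s a] [s' a'] [s'' a''] [p q] [p' q']; cbn in *; destruct p, p'.
  exists eq_refl; exact (strans q q').
Defined.

Definition A_omega : Setoid := MkSetoid omega_equiv.

Lemma stage_dec (s s' : Stage) : {s = s'} + {s <> s'}.
Proof. decide equality. Defined.

Lemma H_ext (s s' : Stage) (p : s = s') (a : A_ s) (x y : F_ s a) :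
  x == y -> H_ p x == H_ p y.
Proof. destruct p; exact (fun h => h). Defined.

Definition omega_act (u v : A_omega) (e : u == v) :
  ExtMap (F_ (projT1 u) (projT2 u)) (F_ (projT1 v) (projT2 v)) :=
  @MkExt (F_ (projT1 u) (projT2 u)) (F_ (projT1 v) (projT2 v))
    (fun x => act (F_ (projT1 v)) (projT2 e) (H_ (projT1 e) x))
    (fun _ _ h => fn_ext _ (H_ext _ h)).

Definition F_omega : Family A_omega.
Proof.
refine (@MkFamily A_omega (fun u => F_ (projT1 u) (projT2 u)) omega_act _ _ _).
- intros [s a] x; apply act_id.
- intros [s a] [s' a'] [p q] [p' q'] x; cbn in *.
  assert (h : p' = p) by (apply UIP_dec, stage_dec).
  destruct h, p'; apply act_irr.
- intros [s a] [s' a'] [s'' a''] [p q] [p' q'] x; cbn in *.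
  destruct p, p'; apply act_comp.
Defined.

End Omega.

(* Main.v *)
(** In a category [CatOfFamily F] a cospan [(f, g)] of maps of setoids has a
    pullback as soon as its set-theoretic pullback is represented by a fibre
    [F x]: a cone over [(f, g)] is, after transporting along the equalities of
    objects, a pointwise pairing. In [F_omega] the two codomains of a cospan
    lie in stages [k = k'], so after moving [f] to stage [k'] the index of the
    next stage [st_p i j k'] built from it has the required fibre. The choice
    does not depend on the proof of [k = k'] because stages have decidable
    equality. *)

Require Import Defs.
From Stdlib Require Import Eqdep_dec.

Lemma act_inv (A : Setoid) (F : Family A) (x y : A)
  (p : x == y) (q : y == x) (u : F x) : act F q (act F p u) == u.
Proof.
exact (strans (act_comp p q (srefl x) u) (act_refl F x u)).
Qed.

Section FibrewisePullbacks.
Context (A : Setoid) (F : Family A).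

Notation cospan := (Cospans (CatOfFamily F)).
Notation left_arrow m := (fib_fst m : FamArrow F).
Notation right_arrow m := (fib_snd m : FamArrow F).

Context (P : cospan -> A)
  (pi1 : forall m : cospan, ExtMap (F (P m)) (F (a_dom (left_arrow m))))
  (pi2 : forall m : cospan, ExtMap (F (P m)) (F (a_dom (right_arrow m)))).

(** [P_ext] makes the choice respect equality of cospans. The other three say elementwise that
    [F (P m)] is a pullback of setoids; [pairing] is asked only pointwise. *)
Context
  (P_ext : forall (m m' : cospan) (e : m == m'),
     { e' : P m == P m' &
       ((act F (projT1 (fst e)) \oe pi1 m =ext pi1 m' \oe act F e') *
        (act F (projT1 (snd e)) \oe pi2 m =ext pi2 m' \oe act F e'))%type })
  (pi_square : forall (m : cospan) (u : F (P m)),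
     act F (fib_eq m) (a_map (left_arrow m) (pi1 m u)) ==
     a_map (right_arrow m) (pi2 m u))
  (pairing : forall (m : cospan) x y,
     act F (fib_eq m) (a_map (left_arrow m) x) == a_map (right_arrow m) y ->
     { u : F (P m) & ((pi1 m u == x) * (pi2 m u == y))%type })
  (pi_mono : forall (m : cospan) (u v : F (P m)),
     pi1 m u == pi1 m v -> pi2 m u == pi2 m v -> u == v).

Definition proj1_arrow : ExtMap cospan (Arr (CatOfFamily F)).
Proof.
refine (@MkExt cospan (Arr (CatOfFamily F))
  (fun m => MkArrow (P m) (a_dom (left_arrow m)) (pi1 m)) _).
intros m m' e; destruct (P_ext _ _ e) as [e' [h1 _]].
exists e', (projT1 (fst e)); exact h1.
Defined.

Definition proj2_arrow : ExtMap cospan (Arr (CatOfFamily F)).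
Proof.
refine (@MkExt cospan (Arr (CatOfFamily F))
  (fun m => MkArrow (P m) (a_dom (right_arrow m)) (pi2 m)) _).
intros m m' e; destruct (P_ext _ _ e) as [e' [_ h2]].
exists e', (projT1 (snd e)); exact h2.
Defined.

Lemma proj_comm_square (m : cospan) :
  @CommSquare (CatOfFamily F) (fib_fst m) (fib_snd m)
    (proj1_arrow m) (proj2_arrow m).
Proof.
unshelve econstructor; try exact (srefl _).
(* Both composites start at [P m]; their codomains are identified by [fib_eq m]. *)
exists (srefl _), (fib_eq m); intros u; cbn.
eapply strans; [do 2 apply fn_ext; apply act_id|].
eapply strans; [apply pi_square|].
apply fn_ext, ssym; eapply strans; [apply act_id|].
apply fn_ext, act_id.
Defined.

Lemma proj_universal (m : cospan) (h k : FamArrow F) :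
  @CommSquare (CatOfFamily F) (fib_fst m) (fib_snd m) h k ->
  { u : FamArrow F &
    (@Mediates (CatOfFamily F) (proj1_arrow m) (proj2_arrow m) h k u *
     (forall v : FamArrow F,
        @Mediates (CatOfFamily F) (proj1_arrow m) (proj2_arrow m) h k v ->
        @seteq (ArrSetoid F) v u))%type }.
Proof.
intros [l r _ [p [q comm]]]; cbn in l, r, p, q, comm.
(* Both legs become functions on [a_dom h]: [p] leads to the domain of [k], while [l] and [r] carry
   the values into the fibres over the domains of the cospan. *)
set (x1 := fun x : F (a_dom h) => act F l (a_map h x)).
set (x2 := fun x : F (a_dom h) => act F r (a_map k (act F p x))).
assert (cone : forall x, act F (fib_eq m) (a_map (left_arrow m) (x1 x)) ==
                         a_map (right_arrow m) (x2 x)).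
(* [comm] gives this along [q], which acts as [fib_eq m] does. *)
{ intros x; eapply strans; [apply act_irr|apply comm]. }
set (med := fun x => projT1 (pairing m (x1 x) (x2 x) (cone x))).
assert (med1 : forall x, pi1 m (med x) == x1 x).
{ intros x; exact (fst (projT2 (pairing m (x1 x) (x2 x) (cone x)))). }
assert (med2 : forall x, pi2 m (med x) == x2 x).
{ intros x; exact (snd (projT2 (pairing m (x1 x) (x2 x) (cone x)))). }
(* The pointwise choice is extensional because the projections are jointly monic. *)
assert (med_ext : forall x y, x == y -> med x == med y).
{ intros x y e; apply pi_mono.
  - eapply strans; [apply med1|]; eapply strans; [|apply ssym, med1].
    do 2 apply fn_ext; exact e.
  - eapply strans; [apply med2|]; eapply strans; [|apply ssym, med2].
    do 3 apply fn_ext; exact e. }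
exists (MkArrow (a_dom h) (P m) (MkExt med_ext)); split.
- unshelve econstructor; try exact (srefl _).
  + exists (srefl _), (ssym l); intros x; cbn.
    eapply strans; [do 2 apply fn_ext; apply act_id|].
    eapply strans; [apply fn_ext, med1|].
    eapply strans; [apply act_inv|apply fn_ext, ssym, act_id].
  + exists p, (ssym r); intros x; cbn.
    eapply strans; [do 2 apply fn_ext; apply act_id|].
    eapply strans; [apply fn_ext, med2|apply act_inv].
- intros v [ml mr [a1 [b1 h1]] [a2 [b2 h2]]].
  cbn in ml, mr, a1, b1, h1, a2, b2, h2.
  exists a1, ml; intros x; cbn; apply pi_mono.
  + eapply strans; [|apply ssym, med1].
    eapply strans; [apply ssym, (act_inv _ _ _ _ b1 l)|apply fn_ext, h1].
  (* The second equation for [v] composes along [mr], so [ml] is exchanged for it first. *)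
  + eapply strans; [apply fn_ext, (act_irr F ml mr)|].
    eapply strans; [|apply ssym, med2].
    eapply strans; [apply ssym, (act_inv _ _ _ _ b2 r)|].
    apply fn_ext; eapply strans; [apply h2|].
    apply fn_ext, ssym, act_comp.
Defined.

Theorem chosen_pullbacks_of_fibrewise : HasChosenPullbacks (CatOfFamily F).
Proof.
exists proj1_arrow, proj2_arrow; intros m.
split; [apply proj_comm_square|exact (proj_universal m)].
Defined.

End FibrewisePullbacks.

Section OmegaPullbacks.
Context (B : Setoid) (G : Family B).

Notation cospan := (Cospans (CatOfFamily (F_omega G))).
Notation left_arrow m := (fib_fst m : FamArrow (F_omega G)).
Notation right_arrow m := (fib_snd m : FamArrow (F_omega G)).

Definition H_map (s s' : Stage) (p : s = s') (a : A_ G s) :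
  ExtMap (F_ G s a) (F_ G s' (transport p a)) :=
  MkExt (fun x y => @H_ext B G s s' p a x y).

Definition omega_pb_index (m : cospan) :
  PbIdx (F_ G (projT1 (a_dom (left_arrow m))))
    (F_ G (projT1 (a_dom (right_arrow m))))
    (F_ G (projT1 (a_cod (right_arrow m)))) :=
  @MkPbIdx _ _ _ (F_ G _) (F_ G _) (F_ G _)
    (projT2 (a_dom (left_arrow m))) (projT2 (a_dom (right_arrow m)))
    (transport (projT1 (fib_eq m)) (projT2 (a_cod (left_arrow m))))
    (projT2 (a_cod (right_arrow m)))
    (projT2 (fib_eq m))
    (H_map _ _ (projT1 (fib_eq m)) _ \oe a_map (left_arrow m))
    (a_map (right_arrow m)).

Definition omega_pb (m : cospan) : A_omega G :=
  existT (fun s => car (A_ G s)) (st_p _ _ _) (omega_pb_index m).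

(** The fibre of [F_omega G] over [omega_pb m] computes to this [PbFiber], so the ascription holds
    by conversion. *)
Definition omega_pi1 (m : cospan) :
  ExtMap (F_omega G (omega_pb m)) (F_omega G (a_dom (left_arrow m))) :=
  @MkExt (PbFiber (omega_pb_index m)) (F_omega G (a_dom (left_arrow m)))
    (fun u => el_x u) (fun _ _ e => fst e).

Definition omega_pi2 (m : cospan) :
  ExtMap (F_omega G (omega_pb m)) (F_omega G (a_dom (right_arrow m))) :=
  @MkExt (PbFiber (omega_pb_index m)) (F_omega G (a_dom (right_arrow m)))
    (fun u => el_y u) (fun _ _ e => snd e).

(** Once the stage paths are eliminated, both indices lie in the same stage, and equality of cospans
    supplies exactly the components of [PbIdxEq]. *)
Lemma omega_pb_ext (m m' : cospan) (e : m == m') :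
  { e' : omega_pb m == omega_pb m' &
    ((act (F_omega G) (projT1 (fst e)) \oe omega_pi1 m =ext
      omega_pi1 m' \oe act (F_omega G) e') *
     (act (F_omega G) (projT1 (snd e)) \oe omega_pi2 m =ext
      omega_pi2 m' \oe act (F_omega G) e'))%type }.
Proof.
destruct m as [[[i a] [k c] f] [[j b] [l d] g] [p q]].
destruct m' as [[[i' a'] [k' c'] f'] [[j' b'] [l' d'] g'] [p' q']].
destruct e as [[[pi ea] [[pk ec] hf]] [[pj eb] [[pl ed] hg]]].
cbn in *; destruct pi, pj, pk, pl, p.
(* [p'] has become a loop at the stage [k], which path elimination alone cannot remove. *)
assert (h : p' = eq_refl) by (apply UIP_dec, stage_dec).
subst p'.
set (m := MkFib _ _ _); set (m' := MkFib _ _ _).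
unshelve eexists.
- exists eq_refl.
  exact (@MkPbIdxEq _ _ _ (F_ G i) (F_ G j) (F_ G k)
    (omega_pb_index m) (omega_pb_index m') ea eb ec ed hf hg).
(* [pb_act] acts componentwise by [ea] and [eb], so both sides compute to the same element. *)
- split; intros u; apply srefl.
Defined.

End OmegaPullbacks.

Theorem theorem4p5 (B : Setoid) (G : Family B) :
  HasChosenPullbacks (CatOfFamily (F_omega G)).
Proof.
apply (chosen_pullbacks_of_fibrewise _ _ _ _ _ (omega_pb_ext B G)).
(* The action of [F_omega G] along [fib_eq m] unfolds to [act] after [H_], so the condition stored
   in the fibre is literally the required square. *)
- intros m u; exact (el_r u).
- intros m x y r.
  exists (@MkPbElt _ _ _ (F_ G _) (F_ G _) (F_ G _) (omega_pb_index B G m) x y r).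
  split; apply srefl.
(* Equality in [PbFiber] compares only the two components. *)
- intros m u v h1 h2; exact (h1, h2).
Qed.
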